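(* Let $\Omega_X$ and $\mathsf{Y}$ be standard Borel spaces, let $h:\Omega_X\to\mathbb{R}$ be measurable, and equip $\Omega_X$ with the kernel $K_{\mathrm{Lap}}^h(\omega,\omega'):=\exp(-|h(\omega)-h(\omega')|)$. Then for every probability measure $\mu$ on $\Omega_X$ with $\int_{\Omega_X}|h|\,d\mu<\infty$ one has $H_{K_{\mathrm{Lap}}^h}(\mu)=H_{K_{\mathrm{Lap}}}(h_\#\mu)$, where $K_{\mathrm{Lap}}(s,t)=\exp(-|s-t|)$ on $\mathbb{R}$, and $\mu\mapsto H_{K_{\mathrm{Lap}}^h}(\mu)$ is concave on this class of probability measures. Consequently, for any jointly distributed $(X,Y)$, with $X$ valued in $\Omega_X$ and $Y$ valued in $\mathsf{Y}$, such that $\mathbb{E}|h(X)|<\infty$, $$H_{K_{\mathrm{Lap}}^h}(X\mid Y)\ \le\ H_{K_{\mathrm{Lap}}^h}(X).$$ When the information gain is defined, this gives $I_{K_{\mathrm{Lap}}^h}(X;Y)\ge 0$.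
   Context: A similarity kernel on a measurable space $\Omega$ is a measurable map $K:\Omega\times\Omega\to[0,1]$ that is symmetric and satisfies $K(\omega,\omega)=1$ for all $\omega$. For a probability measure $\mu$ on $\Omega$, the $K$-entropy is $H_K(\mu):=\int_\Omega-\log\Bigl(\int_\Omega K(\omega,\omega')\,d\mu(\omega')\Bigr)\,d\mu(\omega)\in[0,\infty]$, with $-\log 0:=+\infty$. For a random variable $X$ with law $\mu_X$, $H_K(X):=H_K(\mu_X)$. Conditional $K$-entropy: with $\{\mu_{X\mid Y=y}\}$ a regular conditional law of $X$ given $Y$ and $\mu_Y$ the law of $Y$, $H_K(X\mid Y):=\int_{\mathsf{Y}}H_K(\mu_{X\mid Y=y})\,d\mu_Y(y)\in[0,\infty]$. When $H_K(X)$ and $H_K(X\mid Y)$ are finite, the $K$-information gain is $I_K(X;Y):=H_K(X)-H_K(X\mid Y)$. *)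

(* Defs.v *)
From HB Require Import structures.
From mathcomp Require Import all_boot all_order all_algebra.
From mathcomp Require Import interval_inference.
From mathcomp Require Import all_classical all_reals all_analysis.
From mathcomp Require Import measurable_realfun.

Set Implicit Arguments.
Unset Strict Implicit.
Unset Printing Implicit Defensive.

Import Order.TTheory GRing.Theory Num.Theory.
Import numFieldNormedType.Exports.

Local Open Scope classical_set_scope.
Local Open Scope ring_scope.
Local Open Scope ereal_scope.

#[short(type="completeMetricType")]
HB.structure Definition CompleteMetric (R : numDomainType) :=
  {M of Complete M & Metric R M}.

Definition separable (T : topologicalType) : Prop :=
  exists2 D : set T, countable D & dense D.

(* The measurable space is isomorphic to a Polish space with its Borel
   sigma-algebra. Every measurableType is pointed, so the empty space is left
   out; it carries no probability measure. *)
Definition standard_borel (R : realType) (d : measure_display)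
    (T : measurableType d) : Prop :=
  exists M : completeMetricType R, separable M /\
  exists (f : T -> g_sigma_algebraType (@open M))
         (g : g_sigma_algebraType (@open M) -> T),
    [/\ measurable_fun [set: T] f, measurable_fun setT g,
        cancel f g & cancel g f].

Record similarity_kernel (R : realType) (d : measure_display)
    (T : measurableType d) := SimilarityKernel {
  sk_fun :> T -> T -> R ;
  sk_measurable : measurable_fun [set: T * T] (fun z => sk_fun z.1 z.2) ;
  sk_itv : forall x y, (0 <= sk_fun x y <= 1)%R ;
  sk_sym : forall x y, sk_fun x y = sk_fun y x ;
  sk_refl : forall x, sk_fun x x = 1%R }.

Section laplace_kernel.
Context (R : realType) (d : measure_display) (T : measurableType d).
Variable h : {mfun T >-> R}.

Let lap (x y : T) : R := expR (- `|h x - h y|)%R.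

Let lap_measurable : measurable_fun [set: T * T] (fun z => lap z.1 z.2).
Proof.
apply: measurableT_comp => //; apply: measurableT_comp => //.
apply: measurableT_comp => //; apply: measurable_funB.
- exact: measurableT_comp.
- exact: measurableT_comp.
Qed.

Let lap_itv x y : (0 <= lap x y <= 1)%R.
Proof. by rewrite expR_ge0 /= -expR0 ler_expR oppr_le0. Qed.

Let lap_sym x y : lap x y = lap y x.
Proof. by rewrite /lap distrC. Qed.

Let lap_refl x : lap x x = 1%R.
Proof. by rewrite /lap subrr normr0 oppr0 expR0. Qed.

Definition laplace_kernel_comp : similarity_kernel R T :=
  SimilarityKernel lap_measurable lap_itv lap_sym lap_refl.

End laplace_kernel.

Section laplace_kernel_real.
Context (R : realType).

Let lap (s t : R) : R := expR (- `|s - t|)%R.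

Let lap_measurable : measurable_fun [set: R * R] (fun z => lap z.1 z.2).
Proof.
apply: measurableT_comp => //; apply: measurableT_comp => //.
by apply: measurableT_comp => //; apply: measurable_funB.
Qed.

Let lap_itv s t : (0 <= lap s t <= 1)%R.
Proof. by rewrite expR_ge0 /= -expR0 ler_expR oppr_le0. Qed.

Let lap_sym s t : lap s t = lap t s.
Proof. by rewrite /lap distrC. Qed.

Let lap_refl s : lap s s = 1%R.
Proof. by rewrite /lap subrr normr0 oppr0 expR0. Qed.

Definition laplace_kernel : similarity_kernel R R :=
  SimilarityKernel lap_measurable lap_itv lap_sym lap_refl.

End laplace_kernel_real.
Arguments laplace_kernel R : clear implicits.

(* lne 0 = -oo, so the integrand is +oo where the inner integral vanishes. *)
Definition kentropy (R : realType) (d : measure_display) (T : measurableType d)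
    (K : similarity_kernel R T) (mu : probability T R) : \bar R :=
  \int[mu]_x (- lne (\int[mu]_y (K x y)%:E)).

Section kernel_fiber_probability.
Context (R : realType) (d d' : measure_display) (T : measurableType d)
  (T' : measurableType d') (k : R.-pker T ~> T') (x : T).

(* The library sees k x as a measure only. *)
Definition kernel_prob : set T' -> \bar R := k x.

HB.instance Definition _ := Measure.on kernel_prob.

HB.instance Definition _ :=
  Measure_isProbability.Build _ _ _ kernel_prob (prob_kernel x).

End kernel_fiber_probability.

Definition regular_conditional_law (R : realType) (d dX dY : measure_display)
    (T : measurableType d) (TX : measurableType dX) (TY : measurableType dY)
    (P : probability T R) (X : {RV P >-> TX}) (Y : {RV P >-> TY})
    (k : R.-pker TY ~> TX) : Prop :=
  forall A B, measurable A -> measurable B ->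
    P (X @^-1` A `&` Y @^-1` B) = \int[distribution P Y]_(y in B) k y A.

Definition kentropy_RV (R : realType) (d dX : measure_display)
    (T : measurableType d) (TX : measurableType dX) (K : similarity_kernel R TX)
    (P : probability T R) (X : {RV P >-> TX}) : \bar R :=
  kentropy K (distribution P X).

(* k plays the role of the regular conditional law of X given Y. *)
Definition cond_kentropy (R : realType) (d dX dY : measure_display)
    (T : measurableType d) (TX : measurableType dX) (TY : measurableType dY)
    (K : similarity_kernel R TX)
    (P : probability T R) (Y : {RV P >-> TY}) (k : R.-pker TY ~> TX) : \bar R :=
  \int[distribution P Y]_y kentropy K (kernel_prob k y).

Definition info_gain (R : realType) (d dX dY : measure_display)
    (T : measurableType d) (TX : measurableType dX) (TY : measurableType dY)
    (K : similarity_kernel R TX) (P : probability T R)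
    (X : {RV P >-> TX}) (Y : {RV P >-> TY}) (k : R.-pker TY ~> TX) : \bar R :=
  kentropy_RV K X - cond_kentropy K Y k.

Section mixture.
Context (R : realType) (d : measure_display) (T : measurableType d).
Variables (t : {i01 R}) (mu nu : probability T R).

Definition mixture (A : set T) : \bar R :=
  t%:num%:E * mu A + (1 - t%:num)%:E * nu A.

Let t_ge0 : (0 <= t%:num)%R. Proof. by []. Qed.

Let onem_t_ge0 : (0 <= 1 - t%:num)%R. Proof. by rewrite subr_ge0. Qed.

Let mixtureE : mixture =
  measure_add (mscale (NngNum t_ge0) mu) (mscale (NngNum onem_t_ge0) nu).
Proof. by apply/funext => A; rewrite measure_addE. Qed.

Let mixture0 : mixture set0 = 0.
Proof. by rewrite /mixture !measure0 !mule0 adde0. Qed.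

Let mixture_ge0 A : 0 <= mixture A.
Proof. by apply: adde_ge0; apply: mule_ge0; rewrite ?lee_fin. Qed.

Let mixture_sigma_additive : semi_sigma_additive mixture.
Proof. by rewrite mixtureE; exact: measure_semi_sigma_additive. Qed.

HB.instance Definition _ := isMeasure.Build _ _ _ mixture
  mixture0 mixture_ge0 mixture_sigma_additive.

Let mixture_setT : mixture [set: T] = 1.
Proof.
by rewrite /mixture !probability_setT !mule1 -EFinD addrCA subrr addr0.
Qed.

HB.instance Definition _ :=
  Measure_isProbability.Build _ _ _ mixture mixture_setT.

End mixture.

Definition concave_on (R : realType) (d : measure_display)
    (T : measurableType d) (C : set (probability T R))
    (F : probability T R -> \bar R) : Prop :=
  forall (t : {i01 R}) (mu nu : probability T R), C mu -> C nu ->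
    C (mixture t mu nu) /\
    t%:num%:E * F mu + (1 - t%:num)%:E * F nu <= F (mixture t mu nu).

(* Main.v *)
Require Import Defs.
From HB Require Import structures.
From mathcomp Require Import all_boot all_order all_algebra.
From mathcomp Require Import interval_inference.
From mathcomp Require Import all_classical all_reals all_analysis.
From mathcomp Require Import measurable_realfun.
From mathcomp Require Import ring lra zify.

Set Implicit Arguments.
Unset Strict Implicit.
Unset Printing Implicit Defensive.

Import Order.TTheory GRing.Theory Num.Theory.
Import numFieldNormedType.Exports.

Local Open Scope classical_set_scope.
Local Open Scope ring_scope.
Local Open Scope ereal_scope.

(** Concavity comes from a tangent inequality: a function g depending on mu with
    H(nu) <= int g dnu for all probabilities nu, and equality at nu = mu.
    Integrating it against a family (nu_y) with barycenter mu gives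
    int H(nu_y) <= H(mu). With a two-point family this is concavity, and with
    the conditional laws of X given Y it is the inequality H(X|Y) <= H(X).

    On the real line the tangent inequality comes from the fact that
    exp(-|s-t|) is the Green function of (1 - d^2/ds^2)/2. Let u and v be the
    potentials of mu and nu. The inequality says that
    int (1 + ln(v/u)) dnu - int (v/u) dmu >= 0, and an integration by parts
    rewrites the left side as half of the sum of the relative entropy
    int v ln(v/u) and of the Fisher information int (v/u)'^2 u^2/v. Both are
    nonnegative, the first one because u and v have the same integral.

    For arbitrary measures this would need derivatives of potentials that are
    not smooth, so h is first clamped to [-n, n] and rounded to a grid of step
    e_n = 1/(n+1). On a finite grid, with a = exp(-e_n), the kernel is the
    matrix a^|i-j|, whose inverse is tridiagonal up to the factor 1 - a^2,
    with nonpositive off-diagonal entries and nonnegative column sums. These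
    sign conditions, together with ln x >= 1 - 1/x, give the tangent inequality
    (grid_gibbs).

    Clamping and rounding increase the distances |h x - h y| by at most e_n,
    hence H_n <= H + e_n, while Fatou's lemma gives H <= liminf H_n. So
    H = liminf H_n (kentropy_laplace_limE), and a second use of Fatou's lemma
    passes the barycenter inequality from the grid to h
    (kentropy_barycenter). *)

(** * The Laplace kernel on a finite grid *)

Section grid.
Context {R : realType}.
Local Open Scope ring_scope.
Implicit Types (a : R) (m : nat) (p q f u v : nat -> R).

(** The exponent is |i - j|, since one of the truncated differences is 0. *)
Definition grid_kernel a (i j : nat) : R := a ^+ ((i - j) + (j - i)).

(** The mass [p j] sits at the point [j.+1], which leaves the points [0] and
    [m.+1] free on either side as boundary points. *)
Definition grid_potential a m p (i : nat) : R :=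
  \sum_(j < m) grid_kernel a i j.+1 * p j.

Definition grid_entropy a m p : R :=
  \sum_(i < m) p i * - ln (grid_potential a m p i.+1).

(** Up to the additive constant 1, the derivative of the entropy at [q] in the
    direction of a unit mass at cell [j]. *)
Definition grid_tangent a m q (j : nat) : R :=
  1 - ln (grid_potential a m q j.+1)
  - \sum_(i < m) q i * grid_kernel a i.+1 j.+1 / grid_potential a m q i.+1.

(** The tridiagonal inverse of the kernel, up to the factor [1 - a ^+ 2]: a
    discrete form of [1 - d^2/ds^2]. *)
Definition grid_operator a f (i : nat) : R :=
  (1 + a ^+ 2) * f i.+1 - a * f i - a * f i.+2.

Lemma grid_operator_kernel a (i j : nat) :
  grid_operator a (grid_kernel a ^~ j.+1) i = (1 - a ^+ 2) * (i == j)%:R.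
Proof.
rewrite /grid_operator /grid_kernel.
case: (ltngtP i j) => [ij|ij|<-].
- have [d ->] : exists d, (j = i + d.+1)%N by exists (j - i).-1; lia.
  have -> : (i.+1 - (i + d.+1).+1 + ((i + d.+1).+1 - i.+1) = d.+1)%N by lia.
  have -> : (i - (i + d.+1).+1 + ((i + d.+1).+1 - i) = d.+2)%N by lia.
  have -> : (i.+2 - (i + d.+1).+1 + ((i + d.+1).+1 - i.+2) = d)%N by lia.
  rewrite !exprS mulr0; ring.
- have [d ->] : exists d, (i = j + d.+1)%N by exists (i - j).-1; lia.
  have -> : ((j + d.+1).+1 - j.+1 + (j.+1 - (j + d.+1).+1) = d.+1)%N by lia.
  have -> : ((j + d.+1) - j.+1 + (j.+1 - (j + d.+1)) = d)%N by lia.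
  have -> : ((j + d.+1).+2 - j.+1 + (j.+1 - (j + d.+1).+2) = d.+2)%N by lia.
  rewrite !exprS mulr0; ring.
- have -> : true%:R = 1 :> R by [].
  have -> : (i.+1 - i.+1 + (i.+1 - i.+1) = 0)%N by lia.
  have -> : (i - i.+1 + (i.+1 - i) = 1)%N by lia.
  have -> : (i.+2 - i.+1 + (i.+1 - i.+2) = 1)%N by lia.
  by rewrite expr0 expr1; ring.
Qed.

Lemma grid_operator_potential a m p (i : nat) : (i < m)%N ->
  grid_operator a (grid_potential a m p) i = (1 - a ^+ 2) * p i.
Proof.
move=> im; rewrite /grid_operator /grid_potential !mulr_sumr -!sumrB.
rewrite (bigD1 (Ordinal im))//= [X in _ + X]big1 ?addr0 => [|j /negP ji].
  have := grid_operator_kernel a i i; rewrite /grid_operator eqxx mulr1 => <-.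
  ring.
have := grid_operator_kernel a i j; rewrite /grid_operator.
have -> : (i == j)%N = false by apply/eqP => e; apply: ji; apply/eqP/val_inj.
rewrite mulr0 !mulrA -!mulrBl => ->; exact: mul0r.
Qed.

(** Beyond the support the potential decays geometrically. These two relations
    let the same three-term operator act on every cell, including the first and
    the last. *)
Lemma grid_potential_left a m p :
  grid_potential a m p 0 = a * grid_potential a m p 1.
Proof.
rewrite /grid_potential mulr_sumr; apply: eq_bigr => j _.
by rewrite mulrA /grid_kernel sub0n subn0 subSS sub0n subSS subn0 !add0n exprS.
Qed.

Lemma grid_potential_right a m p :
  grid_potential a m p m.+1 = a * grid_potential a m p m.
Proof.
rewrite /grid_potential mulr_sumr; apply: eq_bigr => -[j jm] _ /=.
rewrite mulrA /grid_kernel -exprS; congr (_ ^+ _ * _); lia.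
Qed.

Lemma grid_potential_gt0 a m p i : 0 < a -> (forall j, 0 <= p j) ->
  \sum_(j < m) p j = 1 -> 0 < grid_potential a m p i.
Proof.
move=> a0 p0 p1; rewrite lt_neqAle sumr_ge0 ?andbT; last first.
  by move=> j _; rewrite mulr_ge0// exprn_ge0// ltW.
apply/negP => /eqP/esym/eqP; rewrite psumr_eq0; last first.
  by move=> j _; rewrite mulr_ge0// exprn_ge0// ltW.
move=> /allP h; move: p1; rewrite big1 => [/eqP|j _].
  by rewrite eq_sym oner_eq0.
have /eqP := h j (mem_index_enum _) => /eqP.
by rewrite /= mulf_eq0 expf_eq0 (gt_eqF a0) andbF/= => /eqP.
Qed.

Lemma sum_grid_operator a m f :
  \sum_(i < m) grid_operator a f i =
  (1 - a) ^+ 2 * (\sum_(i < m) f i.+1) + a * (f 1%N - f 0%N)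
  + a * (f m - f m.+1).
Proof.
elim: m => [|m IH]; first by rewrite !big_ord0; ring.
by rewrite !big_ord_recr/= IH /grid_operator; ring.
Qed.

(** This is where nonnegative column sums of the inverse kernel enter. *)
Lemma sum_grid_operator_ge0 a m f : 0 < a < 1 -> (forall i, 0 <= f i) ->
  f 0%N = a * f 1%N -> f m.+1 = a * f m ->
  0 <= \sum_(i < m) grid_operator a f i.
Proof.
move=> /andP[a0 a1] f0 fl fr; rewrite sum_grid_operator fl fr.
have h x : 0 <= x -> 0 <= a * (x - a * x).
  by move=> x0; rewrite mulr_ge0 ?(ltW a0)// subr_ge0 ler_piMl// ltW.
by rewrite !addr_ge0 ?h// mulr_ge0 ?sqr_ge0// sumr_ge0.
Qed.

Lemma ln_ge_1Binv (x : R) : 0 < x -> 1 - x^-1 <= ln x.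
Proof.
move=> x0; have := @le_ln1Dx R (x^-1 - 1).
rewrite addrCA subrr addr0 lnV ?posrE// => h.
rewrite -lerN2 opprB; apply: h.
by rewrite ltrBrDl subrr invr_gt0.
Qed.

(** Write r for v / u. At cell [i] the diagonal terms of the two sides agree,
    because u r = v. Off the diagonal the operator has coefficient [- a], and
    v_j (1 + ln r_i) - u_j r_i <= v_j ln r_j is [ln_ge_1Binv] at r_j / r_i. *)
Lemma grid_tangent_term a (u v : nat -> R) (i : nat) : 0 < a ->
  (forall j, 0 < u j) -> (forall j, 0 < v j) ->
  grid_operator a (fun j => v j * ln (v j / u j)) i <=
  grid_operator a v i * (1 + ln (v i.+1 / u i.+1))
  - grid_operator a u i * (v i.+1 / u i.+1).
Proof.
move=> a0 u0 v0; rewrite /grid_operator.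
have off j : v j * (1 + ln (v i.+1 / u i.+1)) - u j * (v i.+1 / u i.+1)
    <= v j * ln (v j / u j).
  have rj0 : 0 < v j / u j by rewrite divr_gt0.
  have r0 : 0 < v i.+1 / u i.+1 by rewrite divr_gt0.
  have h := ln_ge_1Binv (divr_gt0 rj0 r0); rewrite ln_div ?posrE// in h.
  have := ler_wpM2l (ltW (v0 j)) h.
  have -> : v j * (1 - ((v j / u j) / (v i.+1 / u i.+1))^-1) =
            v j - u j * (v i.+1 / u i.+1).
    field; by rewrite !gt_eqF.
  by move=> H; lra.
have h1 := ler_wpM2l (ltW a0) (off i).
have h2 := ler_wpM2l (ltW a0) (off i.+2).
have e : u i.+1 * (v i.+1 / u i.+1) = v i.+1 by field; rewrite gt_eqF.
move: h1 h2 e.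
set L := ln (v i.+1 / _); set r := v i.+1 / _.
set L0 := ln _; set L2 := ln _ => h1 h2 e.
have -> : ((1 + a ^+ 2) * v i.+1 - a * v i - a * v i.+2) * (1 + L) -
  ((1 + a ^+ 2) * u i.+1 - a * u i - a * u i.+2) * r =
  (1 + a ^+ 2) * (v i.+1 * L) + (1 + a ^+ 2) * (v i.+1 - u i.+1 * r)
  - a * (v i * (1 + L) - u i * r) - a * (v i.+2 * (1 + L) - u i.+2 * r).
  by ring.
by rewrite e subrr mulr0 addr0; lra.
Qed.

(** The tangent inequality, with q as the point of tangency.
    By [grid_tangent_term] the sum dominates that of the operator applied to
    w = v ln (v / u). As w >= v - u, and the operator sends v - u to a multiple
    of p - q, which has total mass zero, the latter sum is nonnegative. *)
Lemma grid_gibbs a m p q : 0 < a < 1 ->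
  (forall j, 0 <= p j) -> (forall j, 0 <= q j) ->
  \sum_(j < m) p j = 1 -> \sum_(j < m) q j = 1 ->
  let r i := grid_potential a m p i.+1 / grid_potential a m q i.+1 in
  0 <= \sum_(i < m) (p i * (1 + ln (r i)) - q i * r i).
Proof.
move=> a01 p0 q0 p1 q1 /=; have /andP[a0 a1] := a01.
set v := grid_potential a m p; set u := grid_potential a m q.
have v0 j : 0 < v j by exact: grid_potential_gt0.
have u0 j : 0 < u j by exact: grid_potential_gt0.
have a2 : 0 < 1 - a ^+ 2 by rewrite subr_gt0 expr_lt1// ltW.
rewrite -(pmulr_rge0 _ a2) mulr_sumr.
pose w j := v j * ln (v j / u j).
pose z j := w j - (v j - u j).
have z0 j : 0 <= z j.
  have := ler_wpM2l (ltW (v0 j)) (ln_ge_1Binv (divr_gt0 (v0 j) (u0 j))).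
  rewrite subr_ge0; apply: le_trans; rewrite le_eqVlt; apply/orP; left.
  apply/eqP; field; by rewrite !gt_eqF.
have wa i j : v i = a * v j -> u i = a * u j -> z i = a * z j.
  move=> vi ui; rewrite /z /w vi ui.
  have -> : a * v j / (a * u j) = v j / u j by field; rewrite !gt_eqF.
  by ring.
have zS : 0 <= \sum_(i < m) grid_operator a z i.
  apply: sum_grid_operator_ge0 => //; apply: wa.
  - exact: grid_potential_left.
  - exact: grid_potential_left.
  - exact: grid_potential_right.
  - exact: grid_potential_right.
apply: (le_trans zS).
have -> : \sum_(i < m) grid_operator a z i =
          \sum_(i < m) grid_operator a w i.
  have -> : \sum_(i < m) grid_operator a z i =
    \sum_(i < m) (grid_operator a w i
                  - ((1 - a ^+ 2) * p i - (1 - a ^+ 2) * q i)).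
    apply: eq_bigr => -[i im] _ /=.
    rewrite -!(grid_operator_potential _ _ im) /z /grid_operator -/v -/u.
    by ring.
  by rewrite sumrB [X in _ - X]sumrB -!mulr_sumr p1 q1 subrr subr0.
apply: ler_sum => -[i im] _ /=.
apply: (le_trans (grid_tangent_term i a0 u0 v0)).
rewrite !grid_operator_potential// -/v -/u; lra.
Qed.

Lemma grid_tangentE a m p q :
  \sum_(j < m) p j * grid_tangent a m q j =
  \sum_(i < m) (p i * (1 - ln (grid_potential a m q i.+1))
   - q i * (grid_potential a m p i.+1 / grid_potential a m q i.+1)).
Proof.
rewrite sumrB.
under eq_bigr do rewrite mulrBr.
rewrite sumrB; congr (_ - _).
under eq_bigr do rewrite mulr_sumr.
rewrite exchange_big/=; apply: eq_bigr => i _.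
rewrite {3}/grid_potential mulr_suml mulr_sumr; apply: eq_bigr => j _; ring.
Qed.

Lemma grid_entropy_le_tangent a m p q : 0 < a < 1 ->
  (forall j, 0 <= p j) -> (forall j, 0 <= q j) ->
  \sum_(j < m) p j = 1 -> \sum_(j < m) q j = 1 ->
  grid_entropy a m p <= \sum_(j < m) p j * grid_tangent a m q j.
Proof.
move=> a01 p0 q0 p1 q1; have /andP[a0 _] := a01.
rewrite grid_tangentE -subr_ge0 -sumrB.
have /= /le_trans := grid_gibbs a01 p0 q0 p1 q1; apply.
rewrite le_eqVlt; apply/orP; left; apply/eqP; apply: eq_bigr => i _.
rewrite ln_div ?posrE ?grid_potential_gt0//; ring.
Qed.

Lemma grid_entropy_tangent a m q : 0 < a -> (forall j, 0 <= q j) ->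
  \sum_(j < m) q j = 1 ->
  grid_entropy a m q = \sum_(j < m) q j * grid_tangent a m q j.
Proof.
move=> a0 q0 q1; rewrite grid_tangentE /grid_entropy; apply: eq_bigr => i _.
by rewrite divff ?gt_eqF ?grid_potential_gt0//; ring.
Qed.

End grid.

(** * Potentials and entropies of the Laplace kernel *)

Section limn_einf_order.
Context {R : realType}.
Implicit Types u v : (\bar R)^nat.

Lemma le_limn_einf u v : (forall n, u n <= v n) -> limn_einf u <= limn_einf v.
Proof.
move=> uv; rewrite !limn_einf_lim; apply: lee_lim; [exact: is_cvg_einfs..|].
apply: nearW => n; apply: le_ereal_inf_tmp => _ [k nk <-].
by apply: ge_ereal_inf; exists (u k) => //; exists k.
Qed.

End limn_einf_order.

Section laplace_potential.
Context {R : realType} {d : measure_display} {T : measurableType d}.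
Implicit Types (h : {mfun T >-> R}) (mu : probability T R).

Definition laplace_potential h mu (x : T) : R :=
  fine (\int[mu]_y (expR (- `|h x - h y|))%:E).

Lemma measurable_laplace_section h x :
  measurable_fun [set: T] (fun y => (expR (- `|h x - h y|))%:E).
Proof.
apply/measurable_EFinP; apply: measurableT_comp => //.
apply: measurableT_comp => //; apply: measurableT_comp => //.
exact: measurable_funB.
Qed.

Lemma laplace_le1 (s t : R) : (expR (- `|s - t|) <= 1)%R.
Proof. by rewrite -expR0 ler_expR oppr_le0. Qed.

Lemma integral_laplace_le1 h mu x :
  \int[mu]_y (expR (- `|h x - h y|))%:E <= 1.
Proof.
apply: (@le_trans _ _ (\int[mu]_y cst 1 y)).
  apply: ge0_le_integral => //.
  - exact: measurable_laplace_section.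
  - by move=> y _; rewrite lee_fin laplace_le1.
by rewrite integral_cst//= mul1e probability_setT.
Qed.

Lemma EFin_laplace_potential h mu x :
  (laplace_potential h mu x)%:E = \int[mu]_y (expR (- `|h x - h y|))%:E.
Proof.
rewrite /laplace_potential fineK// ge0_fin_numE.
  by rewrite (le_lt_trans (integral_laplace_le1 h mu x))// ltry.
by apply: integral_ge0 => y _; rewrite lee_fin expR_ge0.
Qed.

Lemma laplace_potential_le1 h mu x : (laplace_potential h mu x <= 1)%R.
Proof. by rewrite -lee_fin EFin_laplace_potential integral_laplace_le1. Qed.

Lemma laplace_potential_gt0 h mu x : (0 < laplace_potential h mu x)%R.
Proof.
rewrite -lte_fin EFin_laplace_potential lt_neqAle.
rewrite integral_ge0 ?andbT; last first.
  by move=> y _; rewrite lee_fin expR_ge0.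
apply/eqP => /esym I0.
(* A positive integrand with zero integral would make the space negligible. *)
have /ae_eq_integral_abs : measurable_fun [set: T]
    (fun y => (expR (- `|h x - h y|))%:E) by exact: measurable_laplace_section.
move=> /(_ mu measurableT)[+ _].
under eq_integral do rewrite gee0_abs ?lee_fin ?expR_ge0//.
move=> /(_ I0)[N [mN N0 sN]].
suff : [set: T] `<=` N.
  move=> TN; have : N = setT by apply/seteqP; split.
  move=> NT; move: N0; rewrite NT /= probability_setT => /eqP.
  by rewrite onee_eq0.
move=> y _; apply: sN => /= /(_ Logic.I) [/eqP].
by rewrite gt_eqF// expR_gt0.
Qed.

Lemma measurable_laplace_potential h mu :
  measurable_fun [set: T] (laplace_potential h mu).
Proof.
apply: measurableT_comp => //.
apply: (@measurable_fun_fubini_tonelli_F _ _ _ _ _ mu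
  (fun z => (laplace_kernel_comp h z.1 z.2)%:E)) => [|z].
  by apply/measurable_EFinP; exact: sk_measurable.
by rewrite lee_fin expR_ge0.
Qed.

Lemma nlog_laplace_potential_ge0 h mu x :
  0 <= (- ln (laplace_potential h mu x))%:E.
Proof. by rewrite lee_fin oppr_ge0 ln_le0// laplace_potential_le1. Qed.

Lemma measurable_nlog_laplace_potential h mu :
  measurable_fun [set: T] (fun x => (- ln (laplace_potential h mu x))%:E).
Proof.
apply/measurable_EFinP; apply: measurableT_comp => //.
apply: measurableT_comp; first exact: measurable_ln.
exact: measurable_laplace_potential.
Qed.

Lemma kentropy_laplaceE h mu : kentropy (laplace_kernel_comp h) mu =
  \int[mu]_x (- ln (laplace_potential h mu x))%:E.
Proof.
apply: eq_integral => x _; rewrite -EFin_laplace_potential.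
by rewrite lne_EFin// laplace_potential_gt0.
Qed.

Lemma kentropy_laplace_ge0 h mu : 0 <= kentropy (laplace_kernel_comp h) mu.
Proof.
rewrite kentropy_laplaceE; apply: integral_ge0 => x _.
exact: nlog_laplace_potential_ge0.
Qed.

(** Increasing all distances by at most [c] multiplies the kernel, hence the
    potential, by at least [expR (- c)]. *)
Lemma kentropy_laplace_le h h' mu (c : R) : (0 <= c)%R ->
  (forall x y, `|h' x - h' y| <= `|h x - h y| + c)%R ->
  kentropy (laplace_kernel_comp h') mu <=
  kentropy (laplace_kernel_comp h) mu + c%:E.
Proof.
move=> c0 hh'; rewrite !kentropy_laplaceE.
have -> : c%:E = \int[mu]_x cst c%:E x.
  by rewrite integral_cst//= probability_setT mule1.
rewrite -ge0_integralD//; last 2 first.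
- by move=> x _; exact: nlog_laplace_potential_ge0.
- exact: measurable_nlog_laplace_potential.
apply: ge0_le_integral => //.
- by move=> x _; exact: nlog_laplace_potential_ge0.
- exact: measurable_nlog_laplace_potential.
- by apply: emeasurable_funD => //; exact: measurable_nlog_laplace_potential.
move=> x _ /=; rewrite -EFinD lee_fin lerNl opprD opprK lerBlDr.
have -> : (c = ln (expR c))%R by rewrite expRK.
rewrite -lnM ?posrE ?laplace_potential_gt0 ?expR_gt0//.
rewrite ler_ln ?posrE ?mulr_gt0 ?laplace_potential_gt0 ?expR_gt0//.
rewrite -lee_fin EFinM !EFin_laplace_potential muleC.
rewrite -ge0_integralZl_EFin ?expR_ge0//; last first.
- exact: measurable_laplace_section.
apply: ge0_le_integral => //.
- exact: measurable_laplace_section.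
- by apply: measurable_funeM; exact: measurable_laplace_section.
move=> y _; rewrite -EFinM lee_fin -expRD ler_expR.
by rewrite -subr_ge0 opprK addrAC subr_ge0 addrC.
Qed.

Lemma laplace_potential_cvg (h_ : nat -> {mfun T >-> R}) h mu x :
  (forall y, h_ n y @[n --> \oo] --> h y) ->
  laplace_potential (h_ n) mu x @[n --> \oo] --> laplace_potential h mu x.
Proof.
move=> hh; apply: fine_cvg; rewrite EFin_laplace_potential.
apply: (@dominated_cvg _ _ _ mu setT measurableT _ _ (cst 1)) => //.
- by move=> n; exact: measurable_laplace_section.
- move=> y _; apply: cvg_EFin; first exact: nearW.
  apply: (@cvg_comp _ _ _ _ expR); last exact: continuous_expR.
  by apply: cvgN; apply: cvg_norm; apply: cvgB; exact: hh.
- exact: finite_measure_integrable_cst.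
- by move=> n y _; rewrite gee0_abs ?lee_fin ?expR_ge0// laplace_le1.
Qed.

(** The potentials converge by dominated convergence, the kernels being bounded
    by 1; Fatou's lemma applies to their logarithms. *)
Lemma kentropy_laplace_lsc (h_ : nat -> {mfun T >-> R}) h mu :
  (forall y, h_ n y @[n --> \oo] --> h y) ->
  kentropy (laplace_kernel_comp h) mu <=
  limn_einf (fun n => kentropy (laplace_kernel_comp (h_ n)) mu).
Proof.
move=> hh; rewrite kentropy_laplaceE.
have -> : (fun n => kentropy (laplace_kernel_comp (h_ n)) mu) =
  (fun n => \int[mu]_x (- ln (laplace_potential (h_ n) mu x))%:E).
  by apply/funext => n; rewrite kentropy_laplaceE.
have -> : \int[mu]_x (- ln (laplace_potential h mu x))%:E = \int[mu]_x
    limn_einf (fun n => (- ln (laplace_potential (h_ n) mu x))%:E).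
  apply: eq_integral => x _; apply/esym.
  apply: (cvg_limn_einf_sup _).1; apply: cvg_EFin; first exact: nearW.
  apply: cvgN; apply: (@cvg_comp _ _ _ _ (@ln R)).
    exact: laplace_potential_cvg hh.
  exact: continuous_ln (laplace_potential_gt0 _ _ _).
apply: fatou => // [n|n x _]; first exact: measurable_nlog_laplace_potential.
exact: nlog_laplace_potential_ge0.
Qed.

End laplace_potential.

(** * Functions with values in a finite arithmetic progression *)

Section grid_valued.
Context {R : realType} {d : measure_display} {T : measurableType d}.
Variables (h : {mfun T >-> R}) (tau : T -> nat) (c s : R) (m : nat).
Hypothesis s_gt0 : (0 < s)%R.
Hypothesis tau_lt : forall x, (tau x < m)%N.
Hypothesis h_tau : forall x, h x = (c + s * (tau x)%:R)%R.
Implicit Types (mu : probability T R).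

Let cell (j : nat) : set T := [set x | tau x = j].

Definition cell_mass mu (j : nat) : R := fine (mu (cell j)).

Let measurable_cell j : measurable (cell j).
Proof.
rewrite (_ : cell j = h @^-1` [set c + s * j%:R]%R).
  by rewrite -[_ @^-1` _]setTI; exact: measurable_funP.
apply/seteqP; split => x /=; rewrite /cell /= h_tau; first by move=> ->.
by move=> /addrI /(mulfI (lt0r_neq0 s_gt0)) /eqP; rewrite eqr_nat => /eqP.
Qed.

Let cell_mass_ge0 mu j : (0 <= cell_mass mu j)%R.
Proof. by rewrite fine_ge0. Qed.

Let EFin_cell_mass mu j : (cell_mass mu j)%:E = mu (cell j).
Proof. by rewrite fineK// fin_num_measure. Qed.

Lemma integral_grid_valued mu (f : nat -> R) : (forall j, (0 <= f j)%R) ->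
  \int[mu]_x (f (tau x))%:E = (\sum_(j < m) cell_mass mu j * f j)%:E.
Proof.
move=> f0.
have -> : \int[mu]_x (f (tau x))%:E =
    \int[mu]_x \sum_(j < m) (f j)%:E * (\1_(cell j) x)%:E.
  apply: eq_integral => x _.
  rewrite (bigD1 (Ordinal (tau_lt x)))//= [X in _ + X]big1 ?adde0 => [|j jx].
    by rewrite indicE mem_set// mule1.
  rewrite indicE memNset ?mule0// => e; move/eqP: jx; apply.
  exact/val_inj.
rewrite ge0_integral_sum//; last 2 first.
- by move=> j; apply: measurable_funeM; apply/measurable_EFinP.
- by move=> j x _; rewrite mule_ge0// lee_fin.
rewrite -sumEFin; apply: eq_bigr => j _.
rewrite ge0_integralZl_EFin//; last exact/measurable_EFinP.
by rewrite integral_indic// setIT EFinM EFin_cell_mass muleC.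
Qed.

Lemma sum_cell_mass mu : (\sum_(j < m) cell_mass mu j = 1)%R.
Proof.
apply: EFin_inj; under eq_bigr do rewrite -[cell_mass _ _]mulr1.
rewrite -(@integral_grid_valued mu (cst 1%R))//.
by rewrite (eq_integral (cst 1%E))// integral_cst//= mul1e probability_setT.
Qed.

Let a : R := expR (- s).

Let a01 : (0 < a < 1)%R.
Proof. by rewrite expR_gt0 /= -expR0 ltr_expR oppr_lt0. Qed.

Lemma laplace_grid_kernel x y :
  expR (- `|h x - h y|)%R = grid_kernel a (tau x) (tau y).
Proof.
have -> : (h x - h y = s * ((tau x)%:R - (tau y)%:R))%R by rewrite !h_tau; ring.
rewrite normrM (gtr0_norm s_gt0) -mulNr /grid_kernel /a -expRM_natr.
congr (expR (_ * _)%R); have [ij|ji] := leqP (tau x) (tau y).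
  by rewrite ler0_norm ?subr_le0 ?ler_nat// opprB -natrB//; congr (_%:R); lia.
rewrite ger0_norm ?subr_ge0 ?ler_nat 1?ltnW// -natrB 1?ltnW//.
by congr (_%:R); lia.
Qed.

Lemma laplace_potential_grid mu x :
  laplace_potential h mu x = grid_potential a m (cell_mass mu) (tau x).+1.
Proof.
apply: EFin_inj; rewrite EFin_laplace_potential.
rewrite /grid_potential; under [in RHS]eq_bigr do rewrite mulrC.
rewrite -(@integral_grid_valued mu (fun j => grid_kernel a (tau x).+1 j.+1)).
  apply: eq_integral => y _; rewrite laplace_grid_kernel.
  by rewrite /grid_kernel !subSS.
by move=> j; rewrite exprn_ge0// expR_ge0.
Qed.

Lemma kentropy_grid mu : kentropy (laplace_kernel_comp h) mu =
  (grid_entropy a m (cell_mass mu))%:E.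
Proof.
rewrite kentropy_laplaceE /grid_entropy.
rewrite -(@integral_grid_valued mu
  (fun i => - ln (grid_potential a m (cell_mass mu) i.+1))%R).
  by apply: eq_integral => x _; rewrite laplace_potential_grid.
move=> j; rewrite oppr_ge0 ln_le0// -(sum_cell_mass mu); apply: ler_sum => i _.
rewrite ler_piMl//; have /andP[a0 a1] := a01.
by rewrite exprn_ile1// ltW.
Qed.

(** The entropy of [k y] is at most its tangent at [mu], which is linear in the
    cell masses; these average to those of [mu], where the tangent is exact. *)
Lemma grid_kentropy_barycenter (dY : measure_display) (Y : measurableType dY)
    (rho : probability Y R) (k : Y -> probability T R) (mu : probability T R) :
  (forall A, measurable A -> measurable_fun [set: Y] (fun y => k y A)) ->
  (forall A, measurable A -> mu A = \int[rho]_y k y A) ->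
  measurable_fun [set: Y] (fun y => kentropy (laplace_kernel_comp h) (k y)) /\
  \int[rho]_y kentropy (laplace_kernel_comp h) (k y) <=
  kentropy (laplace_kernel_comp h) mu.
Proof.
move=> mk muE.
have mp j : measurable_fun [set: Y] (fun y => cell_mass (k y) j).
  by apply: measurableT_comp => //; exact: mk.
have mH : measurable_fun [set: Y]
    (fun y => kentropy (laplace_kernel_comp h) (k y)).
  under eq_fun do rewrite kentropy_grid.
  apply/measurable_EFinP; apply: measurable_sum => i.
  apply: measurable_funM => //; apply: measurableT_comp => //.
  apply: measurableT_comp; first exact: measurable_ln.
  by apply: measurable_sum => j; apply: measurable_funM.
split => //.
have ip j : rho.-integrable [set: Y] (fun y => (cell_mass (k y) j)%:E).
  apply: (@le_integrable _ _ _ _ _ _ _ (cst 1%E)) => //.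
  - exact/measurable_EFinP.
  - move=> y _ /=; rewrite normr1 lee_fin ger0_norm// -lee_fin EFin_cell_mass.
    exact: probability_le1.
  - exact: finite_measure_integrable_cst.
have g_int j (r : R) :
    \int[rho]_y (cell_mass (k y) j * r)%:E = (cell_mass mu j * r)%:E.
  under eq_integral do rewrite EFinM.
  rewrite integralZr// EFinM EFin_cell_mass muE//; congr (_ * _).
  by apply: eq_integral => y _; rewrite EFin_cell_mass.
have /andP[a0 _] := a01.
pose g := grid_tangent a m (cell_mass mu).
have -> : kentropy (laplace_kernel_comp h) mu =
    \int[rho]_y (\sum_(j < m) cell_mass (k y) j * g j)%:E.
  rewrite kentropy_grid grid_entropy_tangent//; last exact: sum_cell_mass.
  under [in RHS]eq_integral do rewrite -sumEFin.
  rewrite integral_sum//= -?sumEFin => [|j]; last first.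
    by under eq_fun do rewrite EFinM; exact: integrableZr.
  by apply: eq_bigr => j _; rewrite g_int.
apply: ge0_le_integral => //.
- by move=> y _; exact: kentropy_laplace_ge0.
- apply/measurable_EFinP; apply: measurable_sum => i.
  exact: measurable_funM.
- move=> y _; rewrite kentropy_grid lee_fin.
  by apply: grid_entropy_le_tangent => //; exact: sum_cell_mass.
Qed.

End grid_valued.

(** * Rounding a real function to a finite grid *)

Section discretization.
Context {R : realType}.
Local Open Scope ring_scope.
Implicit Types (n : nat) (r : R).

Definition clamp n r : R := Num.max (- n%:R) (Num.min n%:R r).

Definition grid_index n r : nat := Num.truncn ((clamp n r + n%:R) * n.+1%:R).

(** Rounding down to the grid of step [n.+1%:R^-1] that starts at [- n%:R]; the
    clamping makes the range finite. *)
Definition discretize n r : R := - n%:R + n.+1%:R^-1 * (grid_index n r)%:R.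

Lemma clamp_bounds n r : - n%:R <= clamp n r <= n%:R.
Proof.
rewrite /clamp le_max lexx/= ge_max ge_min lexx/= andbT.
by rewrite (@le_trans _ _ 0)// oppr_le0.
Qed.

Lemma le_clamp n : {homo clamp n : r s / r <= s}.
Proof.
by move=> r s rs; rewrite ge_max !le_max lexx/= !le_min !ge_min lexx rs !orbT.
Qed.

Lemma clamp_lip n r r' : clamp n r - clamp n r' <= `|r - r'|.
Proof.
have d0 := normr_ge0 (r - r'); have dr := ler_norm (r - r').
have /andP[cl _] := clamp_bounds n r'.
rewrite lerBlDr ge_max; apply/andP; split; first by lra.
apply: (@le_trans _ _ (`|r - r'| + Num.min n%:R r')); last first.
  by rewrite lerD2l le_max lexx orbT.
by case: (leP n%:R r') => _; rewrite ge_min; apply/orP; [left|right]; lra.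
Qed.

Let shifted_ge0 n r : 0 <= (clamp n r + n%:R) * n.+1%:R.
Proof.
by rewrite mulr_ge0// -lerBlDr sub0r; have /andP[] := clamp_bounds n r.
Qed.

Lemma grid_index_lt n r : (grid_index n r < (2 * n * n.+1).+1)%N.
Proof.
rewrite truncn_lt_nat//; have /andP[_ cn] := clamp_bounds n r.
apply: (@le_lt_trans _ _ (2 * n * n.+1)%:R); last by rewrite ltr_nat.
by rewrite natrM ler_wpM2r// mul2n -addnn natrD lerD2r.
Qed.

Lemma discretize_bounds n r :
  discretize n r <= clamp n r <= discretize n r + n.+1%:R^-1.
Proof.
have N0 : 0 < n.+1%:R :> R by [].
have /andP[l u] := truncn_itv (shifted_ge0 n r).
rewrite /discretize /grid_index; apply/andP; split.
  by rewrite addrC lerBlDr mulrC ler_pdivrMr.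
rewrite -addrA addrC -lerBlDr opprK -[X in _ <= _ + X]mulr1 -mulrDr mulrC.
by rewrite ler_pdivlMr// natr1 ltW.
Qed.

Lemma le_discretize n : {homo discretize n : r s / r <= s}.
Proof.
move=> r s rs; rewrite lerD2l ler_wpM2l ?invr_ge0// ler_nat le_truncn//.
by rewrite ler_wpM2r// lerD2r le_clamp.
Qed.

Lemma measurable_discretize n : measurable_fun [set: R] (discretize n).
Proof. apply: nondecreasing_measurable => //; exact: le_discretize. Qed.

HB.instance Definition _ n := isMeasurableFun.Build _ _ R R (discretize n)
  (measurable_discretize n).

(** Clamping is a contraction, and rounding moves points by less than a step in
    the same direction, so only one step is lost. *)
Lemma discretize_lip n r r' :
  `|discretize n r - discretize n r'| <= `|r - r'| + n.+1%:R^-1.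
Proof.
have := clamp_lip n r r'; have := clamp_lip n r' r.
rewrite (distrC r' r) => h1 h2.
have /andP[] := discretize_bounds n r; have /andP[] := discretize_bounds n r'.
move: (n.+1%:R^-1) => e *; rewrite ler_norml; apply/andP; split; lra.
Qed.

Lemma cvg_discretize r : discretize n r @[n --> \oo] --> r.
Proof.
apply: (@squeeze_cvgr _ _ _ _ (fun n => r - n.+1%:R^-1) (cst r)).
- near=> n.
  have rn : `|r| <= n%:R by near: n; exact: nbhs_infty_ger.
  have cr : clamp n r = r.
    move: rn; rewrite ler_norml /clamp => /andP[rn1 rn2].
    by rewrite (min_idPr rn2) (max_idPr rn1).
  have := discretize_bounds n r; rewrite cr => /andP[-> h].
  by rewrite andbT lerBlDr.
- rewrite -[X in _ --> X]subr0; apply: cvgB; first exact: cvg_cst.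
  exact: cvg_harmonic.
- exact: cvg_cst.
Unshelve. all: by end_near. Qed.

End discretization.

(** * The barycenter inequality and its consequences *)

Section barycenter.
Context {R : realType} {d : measure_display} {T : measurableType d}.
Variable h : {mfun T >-> R}.

Let h_ (n : nat) : {mfun T >-> R} := discretize n \o h.

Let step (n : nat) : R := n.+1%:R^-1.

Let step_gt0 n : (0 < step n)%R.
Proof. by rewrite invr_gt0. Qed.

Let h_cvg x : h_ n x @[n --> \oo] --> h x.
Proof. exact: cvg_discretize. Qed.

Let limn_einf_le (u : (\bar R)^nat) l :
  (forall n, u n <= l + (step n)%:E) -> limn_einf u <= l.
Proof.
move=> ul; apply: (le_trans (le_limn_einf ul)).
suff : (l + (step n)%:E) @[n --> \oo] --> l.
  by move=> /cvg_limn_einf_sup [-> _].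
rewrite -[X in _ --> X]adde0; apply: cvgeD => //.
- by rewrite fin_num_adde_defl.
- exact: cvg_cst.
- by apply: cvg_EFin; [exact: nearW|exact: cvg_harmonic].
Qed.

(** Lower semicontinuity gives one inequality, [discretize_lip] the other. *)
Lemma kentropy_laplace_limE mu : kentropy (laplace_kernel_comp h) mu =
  limn_einf (fun n => kentropy (laplace_kernel_comp (h_ n)) mu).
Proof.
apply/eqP; rewrite eq_le; apply/andP; split.
  by apply: kentropy_laplace_lsc; exact: h_cvg.
apply: limn_einf_le => n; apply: kentropy_laplace_le.
  exact: ltW.
by move=> x y; exact: discretize_lip.
Qed.

Lemma kentropy_barycenter (dY : measure_display) (Y : measurableType dY)
    (rho : probability Y R) (k : Y -> probability T R) (mu : probability T R) :
  (forall A, measurable A -> measurable_fun [set: Y] (fun y => k y A)) ->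
  (forall A, measurable A -> mu A = \int[rho]_y k y A) ->
  \int[rho]_y kentropy (laplace_kernel_comp h) (k y) <=
  kentropy (laplace_kernel_comp h) mu.
Proof.
move=> mk muE.
have grid n := @grid_kentropy_barycenter _ _ _ (h_ n)
  (fun x => grid_index n (h x)) (- n%:R)%R (step n) (2 * n * n.+1).+1
  (step_gt0 n) (fun x => grid_index_lt n (h x))
  (fun x => erefl) _ _ rho k mu mk muE.
have -> : \int[rho]_y kentropy (laplace_kernel_comp h) (k y) =
  \int[rho]_y limn_einf (fun n => kentropy (laplace_kernel_comp (h_ n)) (k y)).
  by apply: eq_integral => y _; exact: kentropy_laplace_limE.
apply: (@le_trans _ _ (limn_einf (fun n =>
    \int[rho]_y kentropy (laplace_kernel_comp (h_ n)) (k y)))).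
  apply: fatou => // [n|n y _]; first by have [] := grid n.
  exact: kentropy_laplace_ge0.
rewrite kentropy_laplace_limE; apply: le_limn_einf => n.
by have [] := grid n.
Qed.

End barycenter.

Lemma kentropy_laplace_pushforward (R : realType) (d : measure_display)
    (T : measurableType d) (h : {mfun T >-> R}) (mu : probability T R) :
  kentropy (laplace_kernel_comp h) mu =
  kentropy (laplace_kernel R) (distribution mu h).
Proof.
pose nu : probability R R := distribution mu h.
pose i : {mfun R >-> R} := HB.pack (@idfun R)
  (isMeasurableFun.Build _ _ R R idfun (@measurable_id _ _ setT)).
have potE x : laplace_potential h mu x = laplace_potential i nu (h x).
  congr fine; rewrite [RHS]ge0_integral_pushforward//.
  exact: measurable_laplace_section.
rewrite kentropy_laplaceE [RHS](kentropy_laplaceE i nu).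
rewrite [RHS]ge0_integral_pushforward//.
- by apply: eq_integral => x _; rewrite potE.
- exact: measurable_nlog_laplace_potential.
- by move=> x _; exact: nlog_laplace_potential_ge0.
Qed.

Section mixtures.
Context {R : realType} {d : measure_display} {T : measurableType d}.
Variables (t : {i01 R}) (mu nu : probability T R).

Let onem_ge0 : (0 <= 1 - t%:num)%R. Proof. by rewrite subr_ge0. Qed.

Lemma ge0_integral_mixture (f : T -> \bar R) :
  measurable_fun [set: T] f -> (forall x, 0 <= f x) ->
  \int[mixture t mu nu]_x f x =
  t%:num%:E * \int[mu]_x f x + (1 - t%:num)%:E * \int[nu]_x f x.
Proof.
move=> mf f0; have t_ge0 : (0 <= t%:num)%R by [].
rewrite (eq_measure_integral (measure_add (mscale (NngNum t_ge0) mu)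
  (mscale (NngNum onem_ge0) nu))); last first.
  by move=> A _ _; rewrite [RHS]measure_addE.
by rewrite ge0_integral_measure_add// !ge0_integral_mscale.
Qed.

(** The mixture is the barycenter of [mu] and [nu] under a Bernoulli law. *)
Lemma kentropy_laplace_mixture (h : {mfun T >-> R}) :
  t%:num%:E * kentropy (laplace_kernel_comp h) mu +
  (1 - t%:num)%:E * kentropy (laplace_kernel_comp h) nu <=
  kentropy (laplace_kernel_comp h) (mixture t mu nu).
Proof.
have t01 : (0 <= t%:num <= 1)%R by apply/andP.
pose k (b : bool) := if b then mu else nu.
have := @kentropy_barycenter _ _ _ h _ _ (bernoulli_prob t%:num) k
  (mixture t mu nu).
rewrite integral_bernoulli_prob//; last first.
  by move=> b; exact: kentropy_laplace_ge0.
apply => // A mA; rewrite integral_bernoulli_prob//.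
Qed.

End mixtures.

Theorem corollary6p7 (R : realType) (dX dY : measure_display)
    (OmegaX : measurableType dX) (OmegaY : measurableType dY)
    (sbX : standard_borel R OmegaX) (sbY : standard_borel R OmegaY)
    (h : {mfun OmegaX >-> R}) :
  [/\ forall mu : probability OmegaX R,
        \int[mu]_x (`|h x|%R)%:E < +oo ->
        kentropy (laplace_kernel_comp h) mu =
        kentropy (laplace_kernel R) (distribution mu h),
      concave_on
        [set mu : probability OmegaX R | \int[mu]_x (`|h x|%R)%:E < +oo]
        (kentropy (laplace_kernel_comp h))
    & forall (d : measure_display) (T : measurableType d)
        (P : probability T R) (X : {RV P >-> OmegaX}) (Y : {RV P >-> OmegaY})
        (k : R.-pker OmegaY ~> OmegaX),
        'E_P[fun w => `|h (X w)|%R] < +oo ->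
        regular_conditional_law X Y k ->
        cond_kentropy (laplace_kernel_comp h) Y k
          <= kentropy_RV (laplace_kernel_comp h) X /\
        (kentropy_RV (laplace_kernel_comp h) X \is a fin_num ->
         cond_kentropy (laplace_kernel_comp h) Y k \is a fin_num ->
         0 <= info_gain (laplace_kernel_comp h) X Y k)].
Proof.
split.
- by move=> mu _; exact: kentropy_laplace_pushforward.
- move=> t mu nu /= mu1 nu1; split; last exact: kentropy_laplace_mixture.
  rewrite ge0_integral_mixture//.
    by rewrite lte_add_pinfty// lte_mul_pinfty// lee_fin subr_ge0.
  by apply/measurable_EFinP; apply: measurableT_comp.
- move=> d T P X Y k _ rcl.
  have le : cond_kentropy (laplace_kernel_comp h) Y k
      <= kentropy_RV (laplace_kernel_comp h) X.
    apply: kentropy_barycenter => A mA; first exact: measurable_kernel.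
    by have := rcl A setT mA measurableT; rewrite preimage_setT setIT.
  split; first exact: le.
  move=> fX fY; rewrite /info_gain sube_ge0//.
  by rewrite fX orbT.
Qed.
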